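(* $\omega(\mathcal{A}_{\mathrm{PSL}(3,3)})=1067$.
   Context: For a non-abelian group $G$ with center $Z(G)$, the non-commuting graph $\mathcal{A}_G$ is the graph whose vertex set is $G\setminus Z(G)$, two distinct vertices $a,b$ being joined if and only if $ab\neq ba$. A clique of a graph is the vertex set of a complete subgraph; the clique number $\omega(\Gamma)$ is the maximum size (if it exists) of a clique of $\Gamma$. $\mathrm{PSL}(3,3)$ is the projective special linear group of degree 3 over the field with 3 elements. *)

(* Defs.v *)
From HB Require Import structures.
From mathcomp Require Import all_boot all_order all_algebra all_fingroup all_solvable.
Set Implicit Arguments.
Unset Strict Implicit.
Unset Printing Implicit Defensive.

Import GroupScope GRing.Theory.

Record sgraph := SGraph {
  vertex : finType;
  adj : rel vertex;
  adj_sym : symmetric adj;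
  adj_irr : irreflexive adj
}.

Definition clique (Gamma : sgraph) (A : {set vertex Gamma}) : bool :=
  [forall a in A, forall b in A, (a != b) ==> adj a b].

Definition clique_number (Gamma : sgraph) : nat :=
  \max_(A : {set vertex Gamma} | clique A) #|A|.

Section NonCommutingGraph.

Variables (gT : finGroupType) (G : {group gT}).

Definition nc_vertex : finType := {x : gT | x \in G :\: 'Z(G)}.

Definition nc_adj : rel nc_vertex :=
  fun a b => (a != b) && (val a * val b != val b * val a).

Lemma nc_adj_sym : symmetric nc_adj.
Proof. by move=> a b; rewrite /nc_adj eq_sym [X in _ && ~~ X]eq_sym. Qed.

Lemma nc_adj_irr : irreflexive nc_adj.
Proof. by move=> a; rewrite /nc_adj eqxx. Qed.

Definition noncommuting_graph : sgraph := SGraph nc_adj_sym nc_adj_irr.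

End NonCommutingGraph.

Section ProjectiveSpecialLinear.

(* [{'GL_n[F]}] consists of matrices of size n.-1.+1, so the degree is n only *)
(* for 0 < n.                                                                 *)
Variables (n : nat) (F : finFieldType).

Definition SLset : {set {'GL_n[F]}} := [set u | (\det (GLval u) == 1)%R].

Lemma SLset_group_set : group_set SLset.
Proof.
apply/group_setP; split=> [|u v]; first by rewrite inE GL_1E det1.
by rewrite !inE GL_MxE det_mulmx => /eqP-> /eqP->; rewrite mulr1.
Qed.

Definition SL : {group {'GL_n[F]}} := Group SLset_group_set.

Definition PSL : {group coset_of 'Z(SL)} := (SL / 'Z(SL))%G.

End ProjectiveSpecialLinear.

(* Main.v *)
(* Call x in SL_3(3) cyclic if w, wx, wx^2 is a basis for some row vector w. The
   centralizer of a cyclic x consists of polynomials in x, so it is abelian, and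
   every non-identity element commutes with a cyclic one. Hence a maximum clique
   takes one cyclic element from each centralizer of a cyclic element. A cyclic
   element is conjugate to exactly one of the nine companion matrices of determinant 1, which gives
     12 * omega = sum over companions c of |c^G| * (12 / #{cyclic y in C_G(c)}).
   The centralizers have order 13 (four classes), 8 (three), 6 and 9, and contain
   12, 6, 2 and 6 cyclic elements, whence omega = 144 + 351 + 468 + 104 = 1067.
   Finally Z(SL_3(3)) = 1, so PSL_3(3) is isomorphic to SL_3(3). *)

Require Import Defs.
From mathcomp Require Import all_boot all_order all_algebra all_fingroup all_solvable.
From mathcomp Require Import ring.
Set Implicit Arguments.
Unset Strict Implicit.
Unset Printing Implicit Defensive.
Import GroupScope GRing.Theory.

(** * Cliques, isomorphisms and abelian centralizers *)

Lemma noncommuting_cliqueP (gT : finGroupType) (G : {group gT})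
    (A : {set vertex (noncommuting_graph G)}) :
  reflect {in A &, forall a b, commute (val a) (val b) -> a = b} (clique A).
Proof.
apply: (iffP forall_inP) => [cA a b Aa Ab ab | cA a Aa].
  apply/eqP; apply/idPn => nab.
  by have /forall_inP/(_ b Ab)/implyP/(_ nab)/andP[_ /eqP] := cA a Aa.
apply/forall_inP=> b Ab; apply/implyP=> nab; rewrite /= /nc_adj nab /=.
by apply: contra nab => /eqP/(cA a b Aa Ab)/eqP.
Qed.

Lemma clique_number_isog_le (gT rT : finGroupType) (G : {group gT}) (H : {group rT}) :
  G \isog H -> clique_number (noncommuting_graph G) <= clique_number (noncommuting_graph H).
Proof.
case/isogP=> f injf fG; apply/bigmax_leqP=> A /noncommuting_cliqueP cA.
have vG (a : nc_vertex G) : val a \in G by case: a => a /= /setDP[].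
have vZ (a : nc_vertex G) : f (val a) \in H :\: 'Z(H).
  case: a => a /= /setDP[Ga Za]; rewrite -fG inE mem_morphim // andbT.
  rewrite -injm_center //; apply: contra Za => /morphimP[z Gz Zz].
  by move/(injmP injf _ _ Ga Gz)->.
pose g a : vertex (noncommuting_graph H) := Sub (f (val a)) (vZ a).
have gE a : val (g a) = f (val a) by [].
have injg a b : commute (val (g a)) (val (g b)) -> commute (val a) (val b).
  rewrite !gE /commute -!morphM // => /(injmP injf); apply; exact: groupM.
rewrite -(@card_in_imset _ _ g A) => [|a b Aa Ab eab]; last first.
  by apply: cA => //; apply: injg; rewrite eab.
apply: leq_bigmax_cond; apply/noncommuting_cliqueP=> _ _ /imsetP[a Aa ->] /imsetP[b Ab ->].
by move/injg/(cA a b Aa Ab)->.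
Qed.

Lemma clique_number_isog (gT rT : finGroupType) (G : {group gT}) (H : {group rT}) :
  G \isog H -> clique_number (noncommuting_graph G) = clique_number (noncommuting_graph H).
Proof.
by move=> GH; apply/eqP; rewrite eqn_leq !clique_number_isog_le // isog_sym.
Qed.

(** Everything in the abelian group C(x) commutes with its member y, so C(x) lies in C(y), and the
    roles are symmetric. Thus commuting is an equivalence relation among elements with abelian
    centralizers. *)
Lemma abelian_cent1_eq (gT : finGroupType) (G : {group gT}) x y :
  x \in G -> y \in G -> abelian 'C_G[x] -> abelian 'C_G[y] -> y \in 'C[x] ->
  'C_G[x] = 'C_G[y].
Proof.
have sub u v : v \in G -> abelian 'C_G[u] -> v \in 'C[u] -> 'C_G[u] \subset 'C_G[v].
  move=> Gv /centsP cu uv; apply/subsetP=> z Cz; have [Gz _] := setIP Cz.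
  by rewrite inE Gz; apply/cent1P/cu => //; rewrite inE Gv.
move=> Gx Gy cx cy xy; apply/eqP; rewrite eqEsubset !sub //.
by rewrite cent1C.
Qed.

(** Upper bound: two members of a clique lying in the same abelian centralizer would commute, so
    each centralizer receives at most one. Lower bound: choosing one element of [R] per centralizer
    gives a clique, because commuting choices have equal centralizers. *)
Lemma clique_number_cent1 (gT : finGroupType) (G : {group gT}) (R : {set gT}) :
    R \subset G :\: 'Z(G) -> {in R, forall x, abelian 'C_G[x]} ->
    {in G :\: 'Z(G), forall x, exists2 y, y \in R & x \in 'C[y]} ->
  clique_number (noncommuting_graph G) = #|[set 'C_G[x] | x in R]|.
Proof.
move=> /subsetP sRG abR covR; apply/eqP; rewrite eqn_leq; apply/andP; split.
  apply/bigmax_leqP=> A /noncommuting_cliqueP cA.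
  have cov (a : nc_vertex G) : exists y, (y \in R) && (val a \in 'C[y]).
    by have [y Ry ay] := covR _ (valP a); exists y; rewrite Ry.
  have Ga (a : nc_vertex G) : val a \in G by have /setDP[] := valP a.
  pose h a := xchoose (cov a).
  have hR a : h a \in R by have /andP[] := xchooseP (cov a).
  have hC a : val a \in 'C_G[h a].
    by rewrite inE Ga; have /andP[] := xchooseP (cov a).
  rewrite -(@card_in_imset _ _ (fun a => 'C_G[h a]) A) => [|a b Aa Ab eab].
    apply/subset_leq_card/subsetP=> _ /imsetP[a _ ->].
    by apply/imsetP; exists (h a).
  apply: cA => //; have /centsP cab := abR _ (hR b).
  by apply: cab; rewrite // -eab.
(* [r] picks a representative of each centralizer; the clique [A] consists of the elements picked
   for their own centralizer. *)
pose r M := [pick x in R | 'C_G[x] == M].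
pose A := [set a : vertex (noncommuting_graph G) | r 'C_G[val a] == Some (val a)].
apply: leq_trans (_ : #|A| <= _); last first.
  apply: leq_bigmax_cond; apply/noncommuting_cliqueP=> a b.
  rewrite !inE => /eqP ra /eqP rb ab; apply: val_inj.
  have Ga (c : nc_vertex G) : val c \in G by have /setDP[] := valP c.
  have Rr (c : nc_vertex G) : r 'C_G[val c] = Some (val c) -> val c \in R.
    by rewrite /r; case: pickP => // x /andP[Rx _] /Some_inj xc; rewrite -[val c]xc.
  apply: Some_inj; rewrite -ra -rb; congr r.
  apply: abelian_cent1_eq; rewrite ?abR ?Rr //.
  by apply/cent1P.
apply: leq_trans (leq_imset_card (fun a => 'C_G[val a]) _).
apply/subset_leq_card/subsetP=> _ /imsetP[x Rx ->].
(* Only the right-hand copy is unfolded, so the case analysis keeps the equation [rxy] saying which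
   y was picked. *)
have: r 'C_G[x] = r 'C_G[x] by [].
rewrite {2}/r; case: pickP => [y /andP[Ry /eqP yx] rxy | /(_ x)]; last by rewrite Rx eqxx.
apply/imsetP; exists (Sub y (sRG y Ry)); last by rewrite /= yx.
by rewrite inE /= yx rxy.
Qed.

(* 'C_R[x] is the set of all y in R with the same centralizer as x, so it
   contributes k to the sum. *)
Lemma card_cent1_imset (gT : finGroupType) (G : {group gT}) (R : {set gT}) k :
    R \subset G -> {in R, forall x, abelian 'C_G[x]} ->
    {in R, forall x, #|'C_R[x]| %| k} ->
  (k * #|[set 'C_G[x] | x in R]| = \sum_(x in R) k %/ #|'C_R[x]|)%N.
Proof.
move=> sRG abR dvk; rewrite (partition_big_imset (fun x => 'C_G[x])) /=.
rewrite mulnC -sum_nat_const; apply: eq_bigr => _ /imsetP[y Ry ->].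
have CRE x : 'C_R[x] = R :&: 'C_G[x] by rewrite setIA (setIidPl sRG).
have sub x : x \in R -> x \in 'C_G[x] by move=> Rx; rewrite inE cent1id (subsetP sRG).
transitivity (\sum_(x in 'C_R[y]) k %/ #|'C_R[y]|)%N.
  rewrite sum_nat_const muln_divA ?dvk // mulKn //.
  by rewrite card_gt0; apply/set0Pn; exists y; rewrite inE Ry cent1id.
apply/esym/eq_big => [x | x /andP[_ /eqP xy]]; last by rewrite !CRE xy.
rewrite inE; case: (boolP (x \in R)) => //= Rx.
apply/eqP/idP => xy.
  by have := sub x Rx; rewrite xy => /setIP[].
apply: abelian_cent1_eq; rewrite ?abR ?(subsetP sRG) //.
by rewrite cent1C.
Qed.

(** * Cyclic vectors *)

Section Krylov.
Local Open Scope ring_scope.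
Variables (F : fieldType) (n : nat).
Implicit Types (x y P : 'M[F]_n.+1) (w : 'rV[F]_n.+1).

(** Invertible exactly when w is a cyclic vector for x. *)
Definition krylov x w : 'M[F]_n.+1 := \matrix_i (w *m x ^+ i).

(** Used with y = x for the centralizer of x, and with y a conjugate of x to transport cyclic
    vectors. *)
Lemma krylovM x y P w : x *m P = P *m y -> krylov x w *m P = krylov y (w *m P).
Proof.
move=> xP; apply/row_matrixP=> i; rewrite row_mul !rowK -!mulmxA; congr (_ *m _).
elim: (i : nat) => [|k IHk]; first by rewrite !expr0 mul1mx mulmx1.
by rewrite !exprSr -!mulmxE -mulmxA xP mulmxA IHk mulmxA.
Qed.

Lemma krylov_poly x w (b : 'rV[F]_n.+1) :
  b *m krylov x w = w *m \sum_i b 0 i *: x ^+ i.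
Proof.
rewrite mulmx_sum_row mulmx_sumr; apply: eq_bigr => i _.
by rewrite rowK scalemxAr.
Qed.

(** Expand wy in the basis w, wx, ..., wx^n to get wy = wp with p a polynomial in x. Both y and p
    commute with x, so by [krylovM] they agree on the whole basis once they agree on w. *)
Lemma krylov_cent x w y : krylov x w \in unitmx -> x *m y = y *m x ->
  exists b : 'rV_n.+1, y = \sum_i b 0 i *: x ^+ i.
Proof.
move=> uK xy; exists (w *m y *m invmx (krylov x w)); set b := _ *m invmx _.
apply: (can_inj (mulKmx uK)); rewrite (krylovM _ xy).
set p := \sum_i _; have xp : x *m p = p *m x.
  rewrite mulmx_sumr mulmx_suml; apply: eq_bigr => i _.
  by rewrite -scalemxAr -scalemxAl !mulmxE -exprS exprSr.
by rewrite (krylovM _ xp) -krylov_poly mulmxKV.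
Qed.

Lemma krylov_cent_comm x w y z : krylov x w \in unitmx ->
  x *m y = y *m x -> x *m z = z *m x -> y *m z = z *m y.
Proof.
move=> uK /(krylov_cent uK)[b ->] xz.
rewrite mulmx_sumr mulmx_suml; apply: eq_bigr => i _.
rewrite -scalemxAr -scalemxAl; congr (_ *: _).
exact: commr_sym (commrX i (commr_sym xz)).
Qed.

End Krylov.

Lemma det_mx33 (R : comNzRingType) (A : 'M[R]_3) (a := fun i j => A (inord i) (inord j)) :
  (\det A = a 0 0 * (a 1 1 * a 2 2 - a 1 2 * a 2 1)
          - a 0 1 * (a 1 0 * a 2 2 - a 1 2 * a 2 0)
          + a 0 2 * (a 1 0 * a 2 1 - a 1 1 * a 2 0))%R.
Proof.
have E (i j : 'I_3) : A i j = a i j by rewrite /a !inord_val.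
rewrite (expand_det_row _ ord0) !big_ord_recl big_ord0 /cofactor.
rewrite !(expand_det_row _ ord0) !big_ord_recl !big_ord0 /cofactor !det_mx11.
rewrite !mxE !E /= !expr0 !expr1 /bump /= !addn0 !exprS expr0; ring.
Qed.

(* [mx] identifies G with SL_(n+1)(F); the carrier of G is kept abstract because
   conversion in [{'GL_3['F_3]}] unfolds the whole matrix structure. *)
Record SL_embedding (F : fieldType) n (gT : finGroupType) (G : {group gT})
    (mx : gT -> 'M[F]_n.+1) : Prop := {
  SL_embM : forall x y, mx (x * y) = (mx x *m mx y)%R;
  SL_emb_inj : injective mx;
  SL_emb_det : forall x, x \in G -> (\det (mx x) = 1)%R;
  SL_emb_surj : forall A, (\det A = 1)%R -> exists2 x, x \in G & mx x = A
}.

(** * Cyclic elements of a special linear group *)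

Section CyclicElements.
Variables (F : finFieldType) (n : nat) (gT : finGroupType) (G : {group gT}).
Variables (mx : gT -> 'M[F]_n.+1) (mxP : SL_embedding G mx).
Implicit Types x y : gT.

Definition cyclic_elts : {set gT} := [set x in G | [exists w, krylov (mx x) w \in unitmx]].

Lemma cyclic_eltP x :
  reflect (x \in G /\ exists w, krylov (mx x) w \in unitmx) (x \in cyclic_elts).
Proof. by rewrite inE; apply: (iffP andP) => -[Gx /existsP]. Qed.

Lemma SL_cent1P x y :
  reflect (y \in G /\ (mx x *m mx y = mx y *m mx x)%R) (y \in 'C_G[x]).
Proof.
rewrite in_setI; apply: (iffP andP) => -[Gy xy]; split=> //.
  by rewrite -!(SL_embM mxP) (cent1P xy).
by apply/cent1P/(SL_emb_inj mxP); rewrite !(SL_embM mxP).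
Qed.

Lemma SL_emb1 : mx 1 = (1%:M)%R.
Proof.
have u1 : mx 1 \in unitmx by rewrite unitmxE (SL_emb_det mxP) ?group1 ?unitr1.
by apply: (can_inj (mulKmx u1)); rewrite -(SL_embM mxP) mulmx1 mulg1.
Qed.

Lemma SL_emb_unit x : x \in G -> mx x \in unitmx.
Proof. by move=> Gx; rewrite unitmxE (SL_emb_det mxP) ?unitr1. Qed.

Lemma SL_embJ x y : (mx x *m mx y = mx y *m mx (x ^ y))%R.
Proof. by rewrite -!(SL_embM mxP) -conjgC. Qed.

Lemma cyclic_cent1_abelian : {in cyclic_elts, forall x, abelian 'C_G[x]}.
Proof.
move=> x /cyclic_eltP[_ [w uK]].
apply/centsP => y /SL_cent1P[_ xy] z /SL_cent1P[_ xz].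
by apply: (SL_emb_inj mxP); rewrite !(SL_embM mxP); apply: (krylov_cent_comm uK).
Qed.

Lemma memJ_cyclic_elts x y : y \in G -> (x ^ y \in cyclic_elts) = (x \in cyclic_elts).
Proof.
have sub u v : v \in G -> u \in cyclic_elts -> u ^ v \in cyclic_elts.
  move=> Gv /cyclic_eltP[Gu [w uK]]; apply/cyclic_eltP; rewrite groupJ //; split=> //.
  exists (w *m mx v)%R; rewrite -(krylovM _ (SL_embJ u v)).
  by rewrite unitmx_mul uK SL_emb_unit.
move=> Gy; apply/idP/idP=> [xy | /sub]; last exact.
by rewrite -[x](conjgK y) sub ?groupV.
Qed.

End CyclicElements.

(** * Computation over 'F_3 *)

(* A computable copy of 'F_3, with 2 = -1: the matrix operations of the library do
   not evaluate. *)
Local Notation trit := (option bool).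
Local Notation vec := (trit * trit * trit)%type.
Local Notation mat := (vec * vec * vec)%type.
Local Notation F := 'F_3.

Declare Scope trit_scope.
Delimit Scope trit_scope with trit.

Definition add_trit (a b : trit) : trit :=
  match a, b with
  | None, _ => b
  | _, None => a
  | Some x, Some y => if x (+) y then None else Some (~~ x)
  end.

Definition mul_trit (a b : trit) : trit :=
  match a, b with Some x, Some y => Some (~~ (x (+) y)) | _, _ => None end.

Notation "0" := None : trit_scope.
Notation "1" := (Some true) : trit_scope.
Notation "2" := (Some false) : trit_scope.
Notation "- a" := (omap negb a) : trit_scope.
Notation "a + b" := (add_trit a b) : trit_scope.
Notation "a - b" := (add_trit a (omap negb b)) : trit_scope.
Notation "a * b" := (mul_trit a b) : trit_scope.

Definition val3 (a : trit) : F := oapp (fun b : bool => (-1) ^+ (~~ b))%R 0%R a.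

Lemma val3D a b : val3 (a + b)%trit = (val3 a + val3 b)%R.
Proof. by apply: val_inj; case: a b => [[]|] [[]|]. Qed.

Lemma val3M a b : val3 (a * b)%trit = (val3 a * val3 b)%R.
Proof. by apply: val_inj; case: a b => [[]|] [[]|]. Qed.

Lemma val3N a : val3 (- a)%trit = (- val3 a)%R.
Proof. by apply: val_inj; case: a => [[]|]. Qed.

Lemma val3_inj : injective val3.
Proof. by move=> [[]|] [[]|]. Qed.

Lemma val3_surj c : exists a, c = val3 a.
Proof.
by case: c => [[|[|[|]]]] // lt3; [exists None | exists (Some true) | exists (Some false)];
  apply: val_inj.
Qed.

Section Model.
Implicit Types (u v w : vec) (m : mat).

Definition vec3 v : 'rV[F]_3 := \row_j val3 (nth 0%trit [:: v.1.1; v.1.2; v.2] j).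
Definition mat3 m : 'M[F]_3 := \matrix_i vec3 (nth m.2 [:: m.1.1; m.1.2] i).

Local Open Scope trit_scope.

Definition vecmat3 v m : vec :=
  let: (a, b, c) := v in
  let: ((p, q, r), (s, t, u), (x, y, z)) := m in
  (a * p + b * s + c * x, a * q + b * t + c * y, a * r + b * u + c * z).

Definition mul3 m1 m2 : mat := (vecmat3 m1.1.1 m2, vecmat3 m1.1.2 m2, vecmat3 m1.2 m2).

Definition det3 m : trit :=
  let: ((p, q, r), (s, t, u), (x, y, z)) := m in
  p * (t * z - u * y) - q * (s * z - u * x) + r * (s * y - t * x).

Definition trace3 m : trit := m.1.1.1.1 + m.1.2.1.2 + m.2.2.

Definition kry3 m v : mat := (v, vecmat3 v m, vecmat3 (vecmat3 v m) m).

Definition one3 : mat := ((1, 0, 0), (0, 1, 0), (0, 0, 1)).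

Local Close Scope trit_scope.

Lemma vec3_surj (u : 'rV[F]_3) : exists v, u = vec3 v.
Proof.
have [a Ea] := val3_surj (u 0%R (inord 0)).
have [b Eb] := val3_surj (u 0%R (inord 1)).
have [c Ec] := val3_surj (u 0%R (inord 2)).
exists (a, b, c); apply/rowP=> -[[|[|[|]]] //= lti]; rewrite mxE /= -?Ea -?Eb -?Ec;
by congr (u _ _); apply: val_inj; rewrite /= inordK.
Qed.

Lemma mat3_surj (A : 'M[F]_3) : exists m, A = mat3 m.
Proof.
have [u Du] := vec3_surj (row (inord 0) A).
have [v Dv] := vec3_surj (row (inord 1) A).
have [w Dw] := vec3_surj (row (inord 2) A).
exists (u, v, w); apply/row_matrixP=> -[[|[|[|]]] //= lti]; rewrite rowK /= -?Du -?Dv -?Dw;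
by congr row; apply: val_inj; rewrite /= inordK.
Qed.

Lemma vec3_inj : injective vec3.
Proof.
move=> [[a b] c] [[d e] f] /rowP E.
by move: (E (inord 0)) (E (inord 1)) (E (inord 2)); rewrite !mxE !inordK //=;
  do 3!move/val3_inj->.
Qed.

Lemma mat3_inj : injective mat3.
Proof.
move=> [[u v] w] [[x y] z] /row_matrixP E.
move: (E (inord 0)) (E (inord 1)) (E (inord 2)); rewrite !rowK !inordK //=.
by do 3!move/vec3_inj->.
Qed.

Lemma vecmat3E v m : (vec3 v *m mat3 m)%R = vec3 (vecmat3 v m).
Proof.
case: v m => [[a b] c] [[[[p q] r] [[s t] u]] [[x y] z]].
apply/rowP=> j; rewrite !mxE !big_ord_recl big_ord0 !mxE /= addr0 addrA.
by case: j => [[|[|[|]]]] //= _; rewrite !(val3D, val3M).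
Qed.

Lemma mul3E m1 m2 : (mat3 m1 *m mat3 m2)%R = mat3 (mul3 m1 m2).
Proof.
apply/row_matrixP=> i; rewrite row_mul !rowK vecmat3E; congr vec3.
by case: i => [[|[|[|]]]].
Qed.

Lemma kry3E m v : krylov (mat3 m) (vec3 v) = mat3 (kry3 m v).
Proof.
apply/row_matrixP=> i; rewrite !rowK.
case: i => [[|[|[|]]]] //= _; rewrite ?expr0 ?mulmx1 ?expr1 ?vecmat3E //.
by rewrite expr2 -mulmxE mulmxA !vecmat3E.
Qed.

Lemma det3E m : (\det (mat3 m))%R = val3 (det3 m).
Proof.
case: m => [[[[p q] r] [[s t] u]] [[x y] z]].
by rewrite det_mx33 !mxE !inordK //= /det3 !(val3D, val3N, val3M).
Qed.

Lemma det3_eq1 m : (det3 m == 1%trit) = (\det (mat3 m) == 1)%R.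
Proof. by rewrite det3E -(inj_eq val3_inj). Qed.

Lemma unitmx_mat3 m : (mat3 m \in unitmx) = (det3 m != 0%trit).
Proof. by rewrite unitmxE det3E unitfE -(inj_eq val3_inj). Qed.

Lemma trace3E m : (\tr (mat3 m))%R = val3 (trace3 m).
Proof.
case: m => [[[[p q] r] [[s t] u]] [[x y] z]].
by rewrite /mxtrace !big_ord_recl big_ord0 !mxE /= addr0 addrA -!val3D.
Qed.

Lemma mat3_one : mat3 one3 = (1%:M)%R.
Proof.
apply/matrixP=> i j; rewrite !mxE.
by case: i j => [[|[|[|]]] //= ?] [[|[|[|]]] //= ?].
Qed.

End Model.

(** * Exhaustive lists and finite checks *)

Definition trits : seq trit := [:: 0; 1; 2]%trit.
Definition pairs : seq (trit * trit) := [seq (a, b) | a <- trits, b <- trits].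
Definition vectors : seq vec := [seq (p, c) | p <- pairs, c <- trits].
Definition matrices : seq mat :=
  [seq (p, c) | p <- [seq (a, b) | a <- vectors, b <- vectors], c <- vectors].

Lemma mem_trits a : a \in trits.
Proof. by case: a => [[]|]. Qed.

Lemma mem_pairs p : p \in pairs.
Proof. by case: p => a b; apply: allpairs_f; apply: mem_trits. Qed.

Lemma mem_vectors v : v \in vectors.
Proof. by case: v => p c; apply: allpairs_f; [apply: mem_pairs | apply: mem_trits]. Qed.

Lemma mem_matrices m : m \in matrices.
Proof.
by case: m => [[u v] w]; apply: allpairs_f; [apply: allpairs_f |]; apply: mem_vectors.
Qed.

Lemma allpairs_pair_uniq (S T : eqType) (s : seq S) (t : seq T) :
  uniq s -> uniq t -> uniq [seq (a, b) | a <- s, b <- t].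
Proof. by move=> us ut; apply: allpairs_uniq => // -[a b] [c d]. Qed.

Lemma pairs_uniq : uniq pairs.
Proof. exact: allpairs_pair_uniq. Qed.

Lemma vectors_uniq : uniq vectors.
Proof. exact: allpairs_pair_uniq pairs_uniq _. Qed.

Lemma matrices_uniq : uniq matrices.
Proof.
exact: allpairs_pair_uniq (allpairs_pair_uniq vectors_uniq vectors_uniq) vectors_uniq.
Qed.

(** Turns a cardinality into a count along an explicit list, which [vm_compute] can evaluate. *)
Lemma card_count (T : finType) (s : seq T) (P : pred T) :
  uniq s -> (forall x, x \in s) -> #|[set x | P x]| = count P s.
Proof.
move=> us sT; rewrite cardE -size_filter; apply/perm_size/uniq_perm.
- exact: enum_uniq.
- exact: filter_uniq.
- by move=> x; rewrite mem_enum inE mem_filter sT andbT.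
Qed.

Definition cyclic3 m := has (fun v => det3 (kry3 m v) != 0%trit) vectors.

Lemma cyclic3P m : reflect (exists w, krylov (mat3 m : 'M[F]_3) w \in unitmx) (cyclic3 m).
Proof.
apply: (iffP hasP) => [[v _ nz] | [w]].
  by exists (vec3 v); rewrite kry3E unitmx_mat3.
by have [v ->] := vec3_surj w; rewrite kry3E unitmx_mat3; exists v; rewrite ?mem_vectors.
Qed.

(* The lower left entry is the determinant. *)
Definition companion3 (p : trit * trit) : mat :=
  ((0, 1, 0), (0, 0, 1), (1, p.1, p.2))%trit.
Definition e1 : vec := (1, 0, 0)%trit.

Lemma det_companion3 p : det3 (companion3 p) = 1%trit.
Proof. by case: p => [[[]|] [[]|]]. Qed.

Lemma kry3_companion p : kry3 (companion3 p) e1 = one3.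
Proof. by case: p => [[[]|] [[]|]]. Qed.

Lemma krylov_companion p : krylov (mat3 (companion3 p)) (vec3 e1) = (1%:M)%R.
Proof. by rewrite kry3E kry3_companion mat3_one. Qed.

Lemma all_pairs (P : pred (trit * trit)) : all P pairs -> forall p, P p.
Proof. by move/allP=> PP p; apply/PP/mem_pairs. Qed.

Lemma all_vectors (P : pred vec) : all P vectors -> forall v, P v.
Proof. by move/allP=> PP v; apply/PP/mem_vectors. Qed.

(** A matrix commuting with a companion matrix is the Krylov matrix of its own first row v, so the
    centralizer in SL(3,3) is parametrized by these v. *)
Definition in_cent p v := det3 (kry3 (companion3 p) v) == 1%trit.

(** The Krylov matrix of v is the polynomial in the companion matrix with coefficients v, since that
    of [e1] is the identity. The 9 * 27 cases are checked directly. *)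
Lemma companion3_comm p v :
  mul3 (companion3 p) (kry3 (companion3 p) v) = mul3 (kry3 (companion3 p) v) (companion3 p).
Proof.
apply/eqP; move: v; apply: all_vectors; move: p; apply: all_pairs.
by vm_compute.
Qed.

(* The only scalar matrix of determinant 1 over 'F_3 is the identity. *)
Lemma nonscalar3 m : det3 m = 1%trit -> m != one3 ->
  exists v w, det3 (v, vecmat3 v m, w) != 0%trit.
Proof.
pose e2 : vec := (0, 1, 0)%trit; pose e3 : vec := (0, 0, 1)%trit.
(* If the first six pairs fail, each unit vector is an eigenvector and m is diagonal; the last two
   pairs then detect unequal adjacent diagonal entries. *)
pose c : seq (vec * vec) :=
  [:: (e1, e2); (e1, e3); (e2, e1); (e2, e3); (e3, e1); (e3, e2);
      ((1, 1, 0), e3)%trit; ((0, 1, 1), e1)%trit].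
pose P m := [|| det3 m != 1%trit, m == one3 |
   has (fun p => det3 (p.1, vecmat3 p.1 m, p.2) != 0%trit) c].
have /allP/(_ m (mem_matrices m)) : all P matrices by vm_compute.
by case/or3P=> [/eqP nd /nd|/eqP-> _ /eqP|/hasP[[v w] _ vw] _ _]; last by exists v, w.
Qed.

(* Cyclic matrices found by search, each commuting with one of the six noncyclic
   matrices of determinant 1 whose first row is (0, 1, 0). *)
Definition noncyclic_witnesses : seq mat := [::
  ((0, 1, 0), (1, 0, 0), (1, 2, 2)); ((0, 0, 1), (1, 1, 2), (0, 1, 0));
  ((0, 0, 1), (2, 2, 2), (0, 2, 1)); ((0, 1, 1), (2, 2, 1), (1, 2, 1));
  ((0, 0, 1), (1, 2, 1), (0, 1, 0)); ((0, 0, 1), (2, 1, 1), (0, 2, 2))]%trit.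

(** In a basis v, vm, w every non-identity m of determinant 1 takes this form, which leaves only
    27^2 cases. A cyclic matrix is its own witness. *)
Lemma shifted_comm_cyclic r s : det3 ((0, 1, 0)%trit, r, s) = 1%trit ->
  exists m', [/\ det3 m' = 1%trit, cyclic3 m' &
                 mul3 ((0, 1, 0)%trit, r, s) m' = mul3 m' ((0, 1, 0)%trit, r, s)].
Proof.
pose ok m := [|| det3 m != 1%trit, cyclic3 m |
  has (fun m' => [&& det3 m' == 1%trit, cyclic3 m' & mul3 m m' == mul3 m' m])
      noncyclic_witnesses].
have : ok ((0, 1, 0)%trit, r, s).
  by move: s; apply: all_vectors; move: r; apply: all_vectors; vm_compute.
set m := (_, r, s).
case/or3P=> [/eqP//|cm|/hasP[m' _ /and3P[/eqP dm' cm' /eqP mm']]] dm; last by exists m'.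
by exists m.
Qed.

(** * Cyclic elements of SL(3,3) *)

Section SL3.
Variables (gT : finGroupType) (G : {group gT}) (mx : gT -> 'M[F]_3).
Hypothesis mxP : SL_embedding G mx.
Local Notation R := (cyclic_elts G mx).

(** Inverse of [mx] on determinant 1; the default 1 is reached only for other determinants. *)
Definition of_mat3 m : gT := odflt 1 [pick x in G | mx x == mat3 m].

Lemma of_mat3K m : det3 m = 1%trit -> of_mat3 m \in G /\ mx (of_mat3 m) = mat3 m.
Proof.
move/eqP; rewrite det3_eq1 => /eqP/(SL_emb_surj mxP)[x Gx mxx]; rewrite /of_mat3.
by case: pickP => [y /andP[Gy /eqP] // | /(_ x)]; rewrite Gx mxx eqxx.
Qed.

Lemma of_mat3_surj x : x \in G -> exists2 m, det3 m = 1%trit & x = of_mat3 m.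
Proof.
move=> Gx; have [m Em] := mat3_surj (mx x).
have dm : det3 m = 1%trit by apply/eqP; rewrite det3_eq1 -Em (SL_emb_det mxP).
by exists m => //; apply: (SL_emb_inj mxP); rewrite (of_mat3K dm).2.
Qed.

Lemma of_mat3_cyclic m : det3 m = 1%trit -> (of_mat3 m \in R) = cyclic3 m.
Proof.
by case/of_mat3K=> Gm Em; apply/cyclic_eltP/cyclic3P => [[_]|]; rewrite Em.
Qed.

(** * Centralizers of the companion matrices *)

Definition companion p := of_mat3 (companion3 p).

Lemma companion_SL p : companion p \in G.
Proof. by have [] := of_mat3K (det_companion3 p). Qed.

Lemma mx_companion p : mx (companion p) = mat3 (companion3 p).
Proof. by have [] := of_mat3K (det_companion3 p). Qed.

Lemma companion_cyclic p : companion p \in R.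
Proof.
apply/cyclic_eltP; split; first exact: companion_SL.
by exists (vec3 e1); rewrite mx_companion krylov_companion unitmx1.
Qed.

Definition cent_elt p v := of_mat3 (kry3 (companion3 p) v).

Lemma cent_elt_inj p : {in [pred v | in_cent p v] &, injective (cent_elt p)}.
Proof.
move=> v w; rewrite !inE => /eqP/of_mat3K[_ Ev] /eqP/of_mat3K[_ Ew].
by move/(congr1 mx); rewrite Ev Ew => /mat3_inj[].
Qed.

(** As [e1] has identity Krylov matrix, [krylovM] identifies a commuting y with the Krylov matrix of
    e1 y. *)
Lemma cent_companion p : 'C_G[companion p] = cent_elt p @: [set v | in_cent p v].
Proof.
apply/setP=> y; apply/(SL_cent1P mxP)/imsetP=> [[Gy] | [v]].
  rewrite mx_companion => yc.
  have [v Ev] := vec3_surj (vec3 e1 *m mx y)%R.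
  have Ey : mx y = mat3 (kry3 (companion3 p) v).
    by rewrite -kry3E -Ev -(krylovM _ yc) krylov_companion mul1mx.
  have dv : det3 (kry3 (companion3 p) v) = 1%trit.
    by apply/eqP; rewrite det3_eq1 -Ey (SL_emb_det mxP).
  exists v; first by rewrite inE /in_cent dv.
  by apply: (SL_emb_inj mxP); rewrite Ey (of_mat3K dv).2.
rewrite inE => /eqP/of_mat3K[Gv Ev] ->; split=> //.
by rewrite Ev mx_companion !mul3E companion3_comm.
Qed.

Lemma card_cent_companion p : #|'C_G[companion p]| = count (in_cent p) vectors.
Proof.
rewrite cent_companion -(card_count _ vectors_uniq mem_vectors) card_in_imset // => v w.
by rewrite !inE; apply: cent_elt_inj.
Qed.

Lemma card_cyclic_cent_companion p :
  #|'C_R[companion p]| =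
    count (fun v => in_cent p v && cyclic3 (kry3 (companion3 p) v)) vectors.
Proof.
rewrite -(card_count _ vectors_uniq mem_vectors).
rewrite -(@card_in_imset _ _ (cent_elt p)) => [|v w]; last first.
  by rewrite !inE => /andP[Pv _] /andP[Pw _]; apply: cent_elt_inj.
apply: eq_card => y.
have -> : (y \in 'C_R[companion p]) = (y \in R) && (y \in 'C_G[companion p]).
  by rewrite !inE; case: (y \in G); rewrite ?andbF.
rewrite cent_companion; apply/andP/imsetP=> [[Ry /imsetP[v Pv Ey]] | [v Pv Ey]].
  exists v => //; move: Pv Ry; rewrite Ey !inE => Pv.
  by rewrite Pv -of_mat3_cyclic ?(eqP Pv) // inE.
move: Pv; rewrite inE => /andP[Pv cv]; rewrite Ey; split.
  by rewrite of_mat3_cyclic // (eqP Pv).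
by apply: imset_f; rewrite inE.
Qed.

Lemma card_cyclic_cent_dvd p : #|'C_R[companion p]| %| 12.
Proof.
rewrite card_cyclic_cent_companion; move: p; apply: all_pairs.
by vm_compute.
Qed.

Lemma of_mat3_one : of_mat3 one3 = 1.
Proof.
apply: (SL_emb_inj mxP); rewrite (SL_emb1 mxP) -mat3_one.
by case: (@of_mat3K one3).
Qed.

(** Two companion matrices suffice: commuting with the first makes x the Krylov matrix of some v,
    and commuting with the second leaves only v = [e1], which gives the identity. *)
Lemma SL3_center : 'Z(G) = 1.
Proof.
apply/trivgP/subsetP=> x /centerP[Gx cx]; rewrite inE.
have xC p : x \in 'C_G[companion p].
  by rewrite inE Gx; apply/cent1P/cx/companion_SL.
have:= xC (0, 0)%trit; rewrite cent_companion => /imsetP[v Pv Ex].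
have /(SL_cent1P mxP)[_] := xC (1, 0)%trit.
move: Pv; rewrite Ex inE mx_companion => Pv; have [_ ->] := of_mat3K (eqP Pv).
rewrite !mul3E => /mat3_inj E.
pose P u := [==> in_cent (0, 0)%trit u,
  mul3 (companion3 (1, 0)%trit) (kry3 (companion3 (0, 0)%trit) u) ==
  mul3 (kry3 (companion3 (0, 0)%trit) u) (companion3 (1, 0)%trit) => u == e1].
have /implyP/(_ Pv)/implyP : P v by apply: all_vectors; vm_compute.
by rewrite E eqxx => /(_ isT)/eqP ->; rewrite /cent_elt kry3_companion of_mat3_one.
Qed.

Lemma card_SL3 : #|G| = 5616.
Proof.
transitivity #|[set m | det3 m == 1%trit]|; last first.
  by rewrite (card_count _ matrices_uniq mem_matrices); vm_compute.
rewrite -(@card_in_imset _ _ of_mat3) => [|m m']; last first.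
  rewrite !inE => /eqP/of_mat3K[_ Em] /eqP/of_mat3K[_ Em'] /(congr1 mx).
  by rewrite Em Em' => /mat3_inj.
apply: eq_card => x; apply/idP/imsetP=> [/of_mat3_surj[m dm ->] | [m]].
  by exists m; rewrite // inE dm.
by rewrite inE => /eqP/of_mat3K[Gm _] ->.
Qed.

(** * Conjugacy classes of cyclic elements *)

Lemma SL3_conj x m (K : 'M[F]_3) : x \in G -> K \in unitmx ->
    (K *m mx x = mat3 m *m K)%R ->
  det3 m = 1%trit /\ exists2 y, y \in G & x = of_mat3 m ^ y.
Proof.
move=> Gx uK Kx; have dK : (\det K != 0)%R by rewrite -unitfE -unitmxE.
have dm : det3 m = 1%trit.
  apply/eqP; rewrite det3_eq1; apply/eqP/(mulIf dK).
  by rewrite -det_mulmx -Kx det_mulmx (SL_emb_det mxP) // mulr1 mul1r.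
(* d = \det K is 1 or -1, so \det (d *: K) = d ^+ 4 = 1. *)
split=> //; have [y Gy Ey] : exists2 y, y \in G & mx y = (\det K *: K)%R.
  apply: (SL_emb_surj mxP); rewrite detZ.
  have [a Ea] := val3_surj (\det K)%R; move: dK; rewrite Ea.
  by case: a {Ea} => [[]|] // _; apply: val_inj.
exists y => //; apply: (mulgI y); rewrite -conjgC; apply: (SL_emb_inj mxP).
rewrite !(SL_embM mxP) Ey (of_mat3K dm).2.
by rewrite -scalemxAl -scalemxAr Kx.
Qed.

(** In the basis w, wx, wx^2 the matrix of x is a companion matrix whose last row holds the
    coordinates of wx^3. *)
Lemma cyclic_companion x : x \in R -> exists p, x \in companion p ^: G.
Proof.
case/cyclic_eltP=> Gx [w uK].
have [[[a b] c] Ew] := vec3_surj (w *m mx x ^+ 3 *m invmx (krylov (mx x) w))%R.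
have E : (krylov (mx x) w *m mx x =
    mat3 ((0, 1, 0)%trit, (0, 0, 1)%trit, (a, b, c)) *m krylov (mx x) w)%R.
  apply/row_matrixP=> i; rewrite !row_mul !rowK -mulmxA.
  have -> : (mx x ^+ i *m mx x = mx x ^+ i.+1)%R by rewrite exprSr.
  have e2 : vec3 (0, 1, 0)%trit = delta_mx 0%R (inord 1).
    by apply/rowP=> j; rewrite !mxE eqxx -val_eqE /= inordK //; case: j => [[|[|[|]]]].
  have e3 : vec3 (0, 0, 1)%trit = delta_mx 0%R (inord 2).
    by apply/rowP=> j; rewrite !mxE eqxx -val_eqE /= inordK //; case: j => [[|[|[|]]]].
  case: i => [[|[|[|]]]] //= _.
  - by rewrite e2 -rowE rowK inordK.
  - by rewrite e3 -rowE rowK inordK.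
  - by rewrite -Ew mulmxKV.
have [dm [y Gy Ex]] := SL3_conj Gx uK E.
(* The determinant of this matrix is a. *)
have Ea : a = 1%trit by case: a dm {Ew E Ex} => [[]|]; case: b c => [[]|] [[]|].
by exists (b, c); rewrite Ex Ea; apply: memJ_class.
Qed.

(* On a companion matrix with last row (1, b, a) the traces are a and a^2 + 2b, and
   -2b = b over 'F_3. *)
Definition trace_inv x : F * F := (\tr (mx x) ^+ 2 - \tr (mx (x * x)%g), \tr (mx x))%R.

Lemma trace_invJ x y : y \in G -> trace_inv (x ^ y) = trace_inv x.
Proof.
move=> Gy; have tJ z : (\tr (mx (z ^ y)) = \tr (mx z))%R.
  have u := SL_emb_unit mxP Gy.
  have -> : (mx (z ^ y) = invmx (mx y) *m (mx z *m mx y))%R.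
    by rewrite (SL_embJ mxP) mulKmx.
  by rewrite mxtrace_mulC -mulmxA mulmxV // mulmx1.
by rewrite /trace_inv -conjMg !tJ.
Qed.

Lemma trace_inv_companion p : trace_inv (companion p) = (val3 p.1, val3 p.2).
Proof.
rewrite /trace_inv (SL_embM mxP) mx_companion mul3E !trace3E.
by case: p => [[[]|] [[]|]]; congr (_, _); apply: val_inj.
Qed.

Lemma companion_class_inj p q : companion p \in companion q ^: G -> p = q.
Proof.
case/imsetP=> y Gy /(congr1 trace_inv); rewrite trace_invJ // !trace_inv_companion.
by case: p q => [a b] [c d] /= [/val3_inj-> /val3_inj->].
Qed.

(** The cyclic elements split into nine disjoint classes, on each of which f is constant; [idx]
    names the class. *)
Lemma sum_cyclic (f : gT -> nat) : (forall x y, y \in G -> f (x ^ y) = f x) ->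
  (\sum_(x in R) f x = \sum_(p <- pairs) #|companion p ^: G| * f (companion p))%N.
Proof.
move=> fJ; pose idx x := odflt (0, 0)%trit [pick p | x \in companion p ^: G].
have idxE x p : x \in companion p ^: G -> idx x = p.
  rewrite /idx => xp; case: pickP => [q xq | /(_ p)]; last by rewrite xp.
  by apply: companion_class_inj; rewrite -(class_eqP xp) (class_eqP xq) class_refl.
rewrite (partition_big idx predT) //=.
(* The sum is moved to the concrete list [pairs] so that it can later be evaluated. *)
have enumE : perm_eq pairs (index_enum (trit * trit)%type).
  apply: uniq_perm pairs_uniq (index_enum_uniq _) _ => p.
  by rewrite mem_pairs mem_index_enum.
rewrite (perm_big _ enumE) /=; apply: eq_bigr => p _; rewrite -sum_nat_const.
apply: eq_big => [x | x /andP[Rx /eqP xp]].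
  apply/andP/idP=> [[/cyclic_companion[q xq] /eqP<-] | xp]; first by rewrite (idxE _ _ xq).
  rewrite (idxE _ _ xp) eqxx; split=> //.
  by case/imsetP: xp => y Gy ->; rewrite memJ_cyclic_elts ?companion_cyclic.
have [q xq] := cyclic_companion Rx; move: (xq); rewrite -(idxE _ _ xq) xp.
by case/imsetP=> y Gy ->; apply: fJ.
Qed.

Lemma card_cyclic_cent_class x y : y \in G -> #|'C_R[x ^ y]| = #|'C_R[x]|.
Proof.
move=> Gy; rewrite -(cardJg 'C_R[x] y) conjIg -cent1J; congr #|pred_of_set (_ :&: _)|.
by apply/setP=> z; rewrite mem_conjg memJ_cyclic_elts ?groupV.
Qed.

(** Conjugate x so that its first row is (0, 1, 0), take a commuting cyclic matrix there, and
    conjugate it back. *)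
Lemma commuting_cyclic x : x \in G -> x != 1 -> exists2 y, y \in R & x \in 'C[y].
Proof.
move=> Gx nx1; have [m dm Ex] := of_mat3_surj Gx; have [_ Em] := of_mat3K dm.
have [|v [w nz]] := @nonscalar3 m dm.
  by apply: contra_neq nx1 => m1; rewrite Ex m1 of_mat3_one.
pose K := mat3 (v, vecmat3 v m, w).
have uK : K \in unitmx by rewrite unitmx_mat3.
have [[[t r] s] En] := mat3_surj (K *m mx x *m invmx K)%R.
have E : (K *m mx x = mat3 (t, r, s) *m K)%R by rewrite -En mulmxKV.
(* The first row of K m is vm, which is the second row of K. *)
have Et : t = (0, 1, 0)%trit.
  apply: vec3_inj; apply: (can_inj (mulmxK uK)).
  have /(congr1 (row (inord 0))) := E; rewrite !row_mul !rowK inordK //= Ex Em vecmat3E => <-.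
  rewrite vecmat3E; congr vec3.
  by case: v (vecmat3 v m) w {nz K uK En E} => [[? ?] ?] [[[[]|] [[]|]] [[]|]] [[? ?] ?].
rewrite Et in E; have [dn [y Gy ->]] := SL3_conj Gx uK E.
have [m' [dm' cm' mm']] := shifted_comm_cyclic dn.
have [G' E'] := of_mat3K dm'; have [Gn En'] := of_mat3K dn.
exists (of_mat3 m' ^ y); first by rewrite memJ_cyclic_elts ?of_mat3_cyclic.
rewrite cent1J memJ_conjg; apply/cent1P/(SL_emb_inj mxP).
by rewrite !(SL_embM mxP) E' En' !mul3E mm'.
Qed.

(** * The count, and passage to PSL(3,3) *)

Lemma clique_number_SL3 : clique_number (noncommuting_graph G) = 1067.
Proof.
have R1 : 1 \notin R by rewrite -of_mat3_one of_mat3_cyclic.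
have sRG : R \subset G by apply/subsetP=> x /cyclic_eltP[].
have abR := cyclic_cent1_abelian mxP.
rewrite (@clique_number_cent1 _ _ R) //; last first.
- by move=> x; rewrite SL3_center => /setD1P[nx Gx]; apply: commuting_cyclic.
- by rewrite SL3_center subsetD1 sRG.
have dvR : {in R, forall x, #|'C_R[x]| %| 12}.
  move=> x /cyclic_companion[p /imsetP[y Gy ->]].
  by rewrite card_cyclic_cent_class ?card_cyclic_cent_dvd.
apply/eqP; rewrite -(eqn_pmul2l (isT : 0 < 12)) (card_cent1_imset sRG abR dvR).
rewrite (@sum_cyclic (fun x => 12 %/ #|'C_R[x]|)%N) => [|x y Gy]; last first.
  by rewrite card_cyclic_cent_class.
(* Class sizes are indices of centralizers, so each term becomes an expression in 5616 and counts
   over [vectors]. *)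
under eq_bigr => p _ do rewrite -index_cent1 -divgS ?subsetIl // card_SL3
  card_cent_companion card_cyclic_cent_companion.
(* The big operator is locked and must be opened before evaluation to 12 * 1067. *)
by rewrite unlock; vm_compute.
Qed.

End SL3.

Lemma SL_embedding_GLval : SL_embedding (SL 3 'F_3) (@GLval 3 'F_3).
Proof.
split; first exact: GL_MxE.
- exact: val_inj.
- by move=> x; rewrite inE => /eqP.
move=> A dA; have uA : A \is a GRing.unit.
  by rewrite -[_ \is a _]/(A \in unitmx) unitmxE dA unitr1.
by exists (FinRing.Unit uA); rewrite // inE /= dA.
Qed.

Theorem theorem1p3 : clique_number (noncommuting_graph (PSL 3 'F_3)) = 1067.
Proof.
rewrite -(clique_number_SL3 SL_embedding_GLval); apply/esym/clique_number_isog.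
(* The center occurs in the type [coset_of], so it is replaced by 1 in a statement where Z is a
   variable. *)
have trivial_quotient (gT : finGroupType) (H : {group gT}) (Z : {set gT}) :
  Z = 1 -> H \isog (H / Z) by move=> ->; apply: quotient1_isog.
exact: trivial_quotient (SL3_center SL_embedding_GLval).
Qed.
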